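(* Let $r\ge1$ and let $\mathbf b=(b_1,\dots,b_r)$ be integers with $b_1\ge b_2\ge\cdots\ge b_r$ and $b_i\ge i$ for all $i$. Then the Ferrers-cell poset $F_{\mathbf b}$ with rank $\rho(i,c)=c-i$ satisfies $$\mathbb{H}_{F_{\mathbf b},\rho}(q,t)=\sum_{w\in\mathcal W_{\mathbf b}}q^{\sum_{j\in D(w)}(j-1)}\,t^{|D(w)|}.$$ In particular $\mathbb{H}_{F_{\mathbf b},\rho}(q,t)\in\mathbb{N}[q,t]$. The trapezoidal posets $T_{r,s}=\{(i,c):1\le i\le r,\ i\le c\le s-i\}$ (with $s\ge 2r\ge 2$, the same order and the same rank) are obtained by taking $b_i=s-i$.
   Context: $\mathbb N=\{0,1,2,\dots\}$. $q$-Zeta numerator: let $P$ be a finite graded poset with a unique maximum and rank function $\rho:P\to\{0,\dots,H\}$, where $H$ is the maximal rank. For $m\ge 0$ put $A_m(P,\rho;q)=\sum_{x_1\le\cdots\le x_m}q^{\rho(x_1)+\cdots+\rho(x_m)}$ (sum over weak chains in $P$; $A_0=1$). The numerator $\mathbb{H}_{P,\rho}(q,t)$ is the polynomial determined by $\sum_{m\ge 0}A_m(P,\rho;q)t^m=\mathbb{H}_{P,\rho}(q,t)/\prod_{a=0}^{H}(1-q^at)$. Ferrers-cell poset: $F_{\mathbf b}=\{(i,c):1\le i\le r,\ i\le c\le b_i\}$, ordered by $(i,c)\le(j,d)\iff i\ge j$ and $c\le d$, with rank $\rho(i,c)=c-i$. Words: put $M=b_1-1$. For $w\in\{L,R\}^M$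 let $\ell(w)$ be its number of $L$'s and $\iota(w)=\ell(w)+1$. $\mathcal W_{\mathbf b}$ is the set of words $w\in\{L,R\}^M$ with $\ell(w)\le r-1$ such that for every prefix, with $L_k$ letters $L$ and $R_k$ letters $R$, one has $\iota(w)+R_k\le b_{\iota(w)-L_k}$. For $w=w_1\cdots w_M$, $D(w)=\{j: w_j=L\text{ and }(j=1\text{ or }w_{j-1}=R)\}$. *)

(* Defs.v *)
From HB Require Import structures.
From mathcomp Require Import all_boot all_order all_algebra.

Set Implicit Arguments.
Unset Strict Implicit.
Unset Printing Implicit Defensive.

Import Order.TTheory GRing.Theory Num.Theory.

Local Open Scope ring_scope.

(* Polynomials in q are elements of {poly int}; polynomials in q and t are    *)
(* elements of {poly {poly int}}, with t the outer and q the inner variable.  *)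

Section QZeta.

Variables (disp : Order.disp_t) (P : finPOrderType disp) (rho : P -> nat).

Definition qzeta (m : nat) : {poly int} :=
  \sum_(x : m.-tuple P | sorted <=%O x) 'X^(\sum_(y <- x) rho y)%N.

Definition max_rank : nat := \max_(x : P) rho x.

Definition qzeta_den : {poly {poly int}} :=
  \prod_(a < max_rank.+1) (1 - ('X^a)%:P * 'X).

(* The power series identity  sum_m A_m t^m = h / prod_a (1 - q^a t),  with   *)
(* the denominator (a unit of Z[q][[t]], its constant coefficient being 1)    *)
(* cleared and the coefficients of t^n compared.                              *)
Definition is_qzeta_numerator (h : {poly {poly int}}) : Prop :=
  forall n : nat, \sum_(k < n.+1) qzeta_den`_k * qzeta (n - k) = h`_n.

End QZeta.

(* The poset carried by a finite set of cells (i, c), given as a sequence.    *)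
Definition cell_poset (s : seq (nat * nat)) : Type := seq_sub s.

Section CellPoset.

Variable s : seq (nat * nat).

HB.instance Definition _ := Finite.on (cell_poset s).

Definition cell_row (x : cell_poset s) : nat := (ssval x).1.
Definition cell_col (x : cell_poset s) : nat := (ssval x).2.

Definition cell_le (x y : cell_poset s) : bool :=
  (cell_row y <= cell_row x)%N && (cell_col x <= cell_col y)%N.

Fact cell_le_refl : reflexive cell_le.
Proof. by move=> x; rewrite /cell_le !leqnn. Qed.

Fact cell_le_anti : antisymmetric cell_le.
Proof.
move=> x y /andP[/andP[yx1 xy2] /andP[xy1 yx2]]; apply: val_inj => /=.
apply/eqP; rewrite -pair_eqE /= /pair_eq !eqn_leq.
by apply/andP; split; apply/andP; split.
Qed.

Fact cell_le_trans : transitive cell_le.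
Proof.
move=> y x z /andP[yx1 xy2] /andP[zy1 yz2]; apply/andP; split.
  exact: leq_trans zy1 yx1.
exact: leq_trans xy2 yz2.
Qed.

Fact cell_display : Order.disp_t. Proof. exact: Order.Disp tt tt. Qed.

HB.instance Definition _ := Order.Le_isPOrder.Build cell_display (cell_poset s)
  cell_le_refl cell_le_anti cell_le_trans.

Definition cell_rank (x : cell_poset s) : nat := (cell_col x - cell_row x)%N.

End CellPoset.

(* The tuple (b_1, ..., b_r) is given by a function b : nat -> nat of which   *)
(* only the values at 1, ..., r matter; b i >= i forces these to be naturals. *)
Definition ferrers_shape (r : nat) (b : nat -> nat) : Prop :=
  (forall i, (1 <= i < r)%N -> (b i.+1 <= b i)%N) /\
  (forall i, (1 <= i <= r)%N -> (i <= b i)%N).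

Definition ferrers_cells (r : nat) (b : nat -> nat) : seq (nat * nat) :=
  [seq (i, c) | i <- iota 1 r, c <- index_iota i (b i).+1].

Lemma mem_ferrers_cells r b i c :
  ((i, c) \in ferrers_cells r b) = (1 <= i <= r)%N && (i <= c <= b i)%N.
Proof.
apply/allpairsPdep/idP => [[j [d [+ + [-> ->]]]]|/andP[ir ic]].
  by rewrite mem_iota mem_index_iota add1n !ltnS => -> ->.
by exists i, c; rewrite mem_iota mem_index_iota add1n !ltnS.
Qed.

Definition trapezoid_cells (r s : nat) : seq (nat * nat) :=
  [seq (i, c) | i <- iota 1 r, c <- index_iota i (s - i).+1].

Lemma mem_trapezoid_cells r s i c :
  ((i, c) \in trapezoid_cells r s) = (1 <= i <= r)%N && (i <= c <= s - i)%N.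
Proof. exact: (mem_ferrers_cells r (fun i => s - i)%N). Qed.

(* Words over {L, R} are sequences of booleans. *)
Local Notation L := true (only parsing).
Local Notation R := false (only parsing).

Definition ell (w : seq bool) : nat := count_mem L w.
Definition iot (w : seq bool) : nat := (ell w).+1.

Definition admissible (r : nat) (b : nat -> nat) (w : seq bool) : bool :=
  (ell w <= r - 1)%N &&
  [forall k : 'I_(size w).+1,
     (iot w + count_mem R (take k w) <= b (iot w - count_mem L (take k w)))%N].

(* Positions are numbered from 1. *)
Definition Dset (w : seq bool) : seq nat :=
  [seq j <- iota 1 (size w) |
     (nth R w (j - 1) == L) && ((j == 1%N) || (nth L w (j - 2) == R))].

Definition word_poly (r : nat) (b : nat -> nat) : {poly {poly int}} :=
  \sum_(w : (b 1%N - 1).-tuple bool | admissible r b w)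
     ('X^(\sum_(j <- Dset w) (j - 1))%N)%:P * 'X^(size (Dset w)).

(* Main.v *)
(* A word in W_b is a maximal chain of F_b, read from a minimal cell (i, i) up *)
(* to (1, b_1).  For a cell x of rank a let G(x) be the generating function of *)
(* the weak chains above x, let x_L and x_R be the cells reached from x by the *)
(* letters L and R, and x_LR the one reached by both.  Inclusion-exclusion on  *)
(* the first element of a chain gives                                          *)
(*   (1 - q^a t) G(x) = G(x_L) + G(x_R) - G(x_LR).                             *)
(* The weighted sum W(x) of the paths from x to the top, where an initial L is *)
(* not counted as a descent, satisfies                                         *)
(*   W(x) = W(x_L) + W(x_R) - (1 - q^(a+1) t) W(x_LR),                         *)
(* so that G(x) = W(x) / prod_(k >= a) (1 - q^k t) by induction from the top.  *)
(* Finally the chains of F_b are counted by the sum over i of                  *)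
(* G((i, i)) - G((i, i)_L), and the numerator of each summand is the weighted  *)
(* sum of the words starting at (i, i), an initial L now being a descent.      *)

Require Import Defs.
From HB Require Import structures.
From mathcomp Require Import all_boot all_order all_algebra.
From mathcomp Require Import zify ring.

Set Implicit Arguments.
Unset Strict Implicit.
Unset Printing Implicit Defensive.

Import Order.TTheory GRing.Theory Num.Theory.

Local Open Scope ring_scope.

(** Clearing denominators turns the recursion for weak chains into the recursion for lattice words:
    [x_LR] has rank two more than [x], so its denominator lacks one more factor than those of [x_L]
    and [x_R]. That factor weights the correction term on the word side. The chain side is
    [chains_recr], the word side [path_sumS] with [path_sumR]; [path_sum_chain_poly] matches them.
    [qzeta_ferrers] and [word_polyE] then sum over the starting cells on the diagonal. *)

Section BigTuple.

Variables (V : nmodType) (T : finType).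

Lemma big_tuple0 (Q : pred (seq T)) (F : seq T -> V) :
  \sum_(w : 0.-tuple T | Q w) F w = if Q [::] then F [::] else 0.
Proof.
rewrite (eq_bigl (fun w : 0.-tuple T => Q [::])); last by move=> w; rewrite tuple0.
case: (Q [::]); last by rewrite big_pred0_eq.
rewrite (eq_bigr (fun=> F [::])); last by move=> w _; rewrite tuple0.
by rewrite sumr_const card_tuple expn0.
Qed.

Lemma big_tupleS n (Q : pred (seq T)) (F : seq T -> V) :
  \sum_(w : n.+1.-tuple T | Q w) F w =
  \sum_a \sum_(w : n.-tuple T | Q (a :: w)) F (a :: w).
Proof.
rewrite pair_big_dep /=.
rewrite (reindex (fun p : T * n.-tuple T => [tuple of p.1 :: p.2])) //=.
exists (fun w : n.+1.-tuple T => (thead w, [tuple of behead w])).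
  by move=> [a w] _; congr (_, _); apply: val_inj.
by move=> w _; rewrite [RHS]tuple_eta; apply: val_inj.
Qed.

End BigTuple.

(** * Weak chains of cells and inclusion-exclusion on their first element *)

Section Chains.

Variable s : seq (nat * nat).

Lemma big_cell_poset (V : nmodType) (Q : pred (nat * nat)) (F : nat * nat -> V) :
  uniq s ->
  \sum_(x : cell_poset s | Q (ssval x)) F (ssval x) = \sum_(p <- s | Q p) F p.
Proof.
move=> Us; rewrite -(big_map (@ssval _ s) Q F).
apply: perm_big; apply: uniq_perm => //.
  by rewrite map_inj_uniq ?index_enum_uniq //; apply: val_inj.
move=> p; apply/mapP/idP => [[x _ ->]|ps]; first exact: ssvalP.
by exists (SeqSub ps) => //; apply: mem_index_enum.
Qed.

(* [chains m i c] is the sum over the weak chains of [m] cells that lie weakly *)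
(* above [(i, c)]; it makes sense for pairs [(i, c)] that are not cells.       *)
(* Row [0] has to vanish at [m = 0] too for the recursion to hold at row [1].  *)
Fixpoint chains (m i c : nat) : {poly int} :=
  if m is m'.+1 then
    \sum_(p <- s | (p.1 <= i)%N && (c <= p.2)%N) 'X^(p.2 - p.1) * chains m' p.1 p.2
  else (0 < i)%:R.

Hypothesis s_uniq : uniq s.
Hypothesis s_gt0 : forall p, p \in s -> (0 < p.1)%N.

Lemma chains_path m (y : cell_poset s) :
  \sum_(x : m.-tuple (cell_poset s) | path <=%O y x)
     'X^(\sum_(z <- x) cell_rank z)%N = chains m (cell_row y) (cell_col y).
Proof.
elim: m y => [|m IHm] y.
  rewrite (big_tuple0 (path <=%O y) (fun x => 'X^(\sum_(z <- x) cell_rank z)%N)) /=.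
  by rewrite big_nil expr0 s_gt0 //; apply: ssvalP.
rewrite (big_tupleS _ (path <=%O y) (fun x => 'X^(\sum_(z <- x) cell_rank z)%N)) /=.
rewrite -(big_cell_poset _ (fun p => _ * chains m p.1 p.2)) //.
rewrite [RHS]big_mkcond /=; apply: eq_bigr => z _.
have -> : (((ssval z).1 <= cell_row y) && (cell_col y <= (ssval z).2))%N = (y <= z)%O.
  by [].
case: (y <= z)%O; last by rewrite big_pred0_eq.
rewrite -[chains _ _ _]/(chains m (cell_row z) (cell_col z)) -IHm mulr_sumr.
by apply: eq_bigr => x _; rewrite big_cons exprD.
Qed.

Lemma qzetaS m :
  qzeta (@cell_rank s) m.+1 = \sum_(p <- s) 'X^(p.2 - p.1) * chains m p.1 p.2.
Proof.
rewrite /qzeta.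
rewrite (big_tupleS _ (sorted <=%O) (fun x => 'X^(\sum_(z <- x) cell_rank z)%N)) /=.
rewrite -(big_cell_poset predT (fun p => _ * chains m p.1 p.2)) //=.
apply: eq_bigr => z _.
rewrite -[chains _ _ _]/(chains m (cell_row z) (cell_col z)) -chains_path mulr_sumr.
by apply: eq_bigr => x _; rewrite big_cons exprD.
Qed.

Lemma qzeta0 : qzeta (@cell_rank s) 0 = 1.
Proof.
rewrite /qzeta.
rewrite (big_tuple0 (sorted <=%O) (fun x => 'X^(\sum_(z <- x) cell_rank z)%N)) /=.
by rewrite big_nil expr0.
Qed.

Lemma chains_row0 m c : chains m 0 c = 0.
Proof.
case: m => [//|m] /=; rewrite big_seq_cond big_pred0 // => p.
by apply/negP => /and3P[/s_gt0]; case: p.1.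
Qed.

(* Inclusion-exclusion: apart from [(i.+1, c)] itself, the cells above         *)
(* [(i.+1, c)] lie above [(i, c)] or [(i.+1, c.+1)], and those above both lie  *)
(* above [(i, c.+1)].                                                          *)
Lemma chains_recr m i c : (i.+1, c) \in s ->
  chains m.+1 i.+1 c = 'X^(c - i.+1) * chains m i.+1 c
    + (chains m.+1 i c + chains m.+1 i.+1 c.+1 - chains m.+1 i c.+1).
Proof.
move=> sic /=; apply/eqP; rewrite addrA eq_sym subr_eq eq_sym; apply/eqP.
have -> : 'X^(c - i.+1) * chains m i.+1 c =
    \sum_(p <- s | p == (i.+1, c)) 'X^(p.2 - p.1) * chains m p.1 p.2.
  by rewrite -big_filter filter_pred1_uniq // big_seq1.
rewrite (big_mkcond (pred1 (i.+1, c))) !(big_mkcond (fun p => _ && _)) -!big_split.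
apply: eq_bigr => -[j d] _ /=; rewrite -!mulrb -!mulrnDr xpair_eqE; congr (_ *+ _).
rewrite [(j <= i.+1)%N]leq_eqVlt [(c <= d)%N]leq_eqVlt -[(j <= i)%N]ltnS.
by case: (ltngtP j i.+1) => _; case: (ltngtP c d).
Qed.

(** Used when the letter [R] leaves the diagram: two terms of the inclusion-exclusion then
    cancel. *)
Lemma chains_empty_row m i c : (0 < i)%N ->
  (forall p, p \in s -> p.1 = i.+1 -> (p.2 < c)%N) ->
  chains m i.+1 c = chains m i c.
Proof.
case: m => [|m] i_gt0 row /=; first by case: i i_gt0 {row}.
rewrite big_seq_cond [RHS]big_seq_cond; apply: eq_bigl => p.
case: p (row p) => j d /= rowjd; case: ((j, d) \in s) rowjd => //= /(_ isT).
by rewrite (leq_eqVlt j) ltnS; case: eqP => //= -> /(_ erefl) dc; rewrite leqNgt dc !andbF.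
Qed.

End Chains.

(** * Words as weighted lattice paths *)

Section Words.

Variables (b : nat -> nat).

Local Notation L := true (only parsing).
Local Notation R := false (only parsing).

(* Words are read as lattice paths: from [(i, c)], the letter [L] leads to     *)
(* [(i.-1, c)] and the letter [R] to [(i, c.+1)].                              *)
Fixpoint path_word (i c : nat) (w : seq bool) : bool :=
  (c <= b i)%N &&
  match w with
  | [::] => i == 1%N
  | L :: w' => (1 < i)%N && path_word i.-1 c w'
  | R :: w' => path_word i c.+1 w'
  end.

(* [a] is the rank of the starting point and [p] the letter preceding [w]. *)
Fixpoint word_weight (a : nat) (p : bool) (w : seq bool) : {poly {poly int}} :=
  if w is l :: w' then
    (if l && ~~ p then ('X^a)%:P * 'X else 1) * word_weight a.+1 l w'
  else 1.

Definition path_sum (n i c : nat) (p : bool) : {poly {poly int}} :=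
  \sum_(w : n.-tuple bool | path_word i c w) word_weight (c - i) p w.

(** Each [L] lowers the row by one and a path must end in row [1], which forces the starting row;
    the bound at each visited cell is the prefix condition. *)
Lemma path_wordE i c w : (0 < i)%N ->
  path_word i c w = (i == iot w) &&
    [forall k : 'I_(size w).+1,
       (c + count_mem R (take k w) <= b (i - count_mem L (take k w)))%N].
Proof.
have forall_ordS n (Q : pred nat) :
    [forall k : 'I_n.+1, Q k] = Q 0%N && [forall k : 'I_n, Q k.+1].
  apply/forallP/andP => [Qk|[Q0 /forallP Qk] k].
    split; first exact: (Qk ord0).
    by apply/forallP => k; have := Qk (lift ord0 k); rewrite lift0.
  by case: (unliftP ord0 k) => [k'|] -> //; rewrite lift0.
pose Q i c w k := (c + count_mem R (take k w) <= b (i - count_mem L (take k w)))%N.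
rewrite /iot /ell -/(Q i c w _); elim: w i c => [|l w IHw] i c i_gt0 /=.
  rewrite (forall_ordS _ (Q i c [::])) /Q /= addn0 subn0 andbC; congr (_ && _).
  by rewrite -[LHS]andbT; congr (_ && _); apply/esym/forallP => -[].
rewrite (forall_ordS _ (Q i c (l :: w))) {1}/Q /= addn0 subn0.
rewrite andbCA; congr (_ && _); case: l => /=.
  case: i i_gt0 => // -[|i] _ //=.
  by rewrite IHw // add1n eqSS.
rewrite IHw // add0n; congr (_ && _).
by apply: eq_forallb => k; rewrite /Q /= add1n addSnnS.
Qed.

Lemma path_sum0 i c p : path_sum 0 i c p = ((c <= b i)%N && (i == 1%N))%:R.
Proof.
rewrite /path_sum (big_tuple0 (path_word i c) (word_weight (c - i) p)) /=.
by case: (_ && _).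
Qed.

Lemma path_sum_out n i c p : (b i < c)%N -> path_sum n i c p = 0.
Proof.
move=> bic; rewrite /path_sum big_pred0 // => -[[|l w] /= _]; by rewrite leqNgt bic.
Qed.

Lemma path_sumS n i c p : (0 < i <= c)%N -> (c <= b i)%N ->
  path_sum n.+1 i c p =
    (if (1 < i)%N
     then (if p then 1 else ('X^(c - i))%:P * 'X) * path_sum n i.-1 c L else 0)
    + path_sum n i c.+1 R.
Proof.
move=> /andP[i_gt0 ic] cb.
rewrite {1}/path_sum (big_tupleS _ (path_word i c) (word_weight (c - i) p)).
rewrite big_bool /= cb /=; congr (_ + _).
  case: (ltnP 1 i) => /= i_gt1; last by rewrite big_pred0_eq.
  rewrite /path_sum mulr_sumr; apply: eq_bigr => w _.
  have -> : (c - i.-1 = (c - i).+1)%N by lia.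
  by case: p.
by rewrite /path_sum subSn //; apply: eq_bigr => w _; rewrite mul1r.
Qed.

(* An initial [L] is a descent only when the preceding letter is [R]. *)
Lemma path_sumR n i c : (1 < i <= c)%N -> (c <= b i)%N ->
  path_sum n.+1 i c R =
    path_sum n.+1 i c L - (1 - ('X^(c - i))%:P * 'X) * path_sum n i.-1 c L.
Proof.
move=> /andP[i_gt1 ic] cb; rewrite !path_sumS ?i_gt1 ?(ltnW i_gt1) //; ring.
Qed.

(** No path starting in row [1] begins with [L], so the preceding letter cannot matter. *)
Lemma path_sum_row1 n c : path_sum n 1 c R = path_sum n 1 c L.
Proof.
case: n => [|n]; first by rewrite !path_sum0.
by apply: eq_bigr => -[[|[] w] /= _] //; rewrite andbF.
Qed.

Lemma word_weightE a p w :
  word_weight a p w =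
  \prod_(k < size w | nth false w k && ~~ nth true (p :: w) k) (('X^(a + k))%:P * 'X).
Proof.
elim: w a p => [|l w IHw] a p /=; first by rewrite big_ord0.
rewrite big_mkcond big_ord_recl /= addn0; congr (_ * _).
rewrite IHw big_mkcond; apply: eq_bigr => k _.
by rewrite /= /bump /= add1n addSnnS.
Qed.

Lemma word_weight_Dset w :
  ('X^(\sum_(j <- Dset w) (j - 1))%N)%:P * 'X^(size (Dset w)) = word_weight 0 R w.
Proof.
have -> (s : seq nat) : ('X^(\sum_(j <- s) (j - 1))%N)%:P * 'X^(size s) =
    \prod_(j <- s) (('X^(j - 1))%:P * 'X) :> {poly {poly int}}.
  elim: s => [|j s IHs]; first by rewrite !big_nil mulr1.
  by rewrite !big_cons -IHs exprD polyCM exprS; ring.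
rewrite word_weightE big_filter -[1%N]addn0 iotaDl big_map.
rewrite -[X in iota 0 X]subn0 big_mkord; apply: eq_big => [k|k _]; last first.
  by rewrite add1n subn1.
rewrite add1n subn1 eqbF_neg eqb_id /=; case: k => -[|k] k_lt //=.
by rewrite !subSS subn0.
Qed.

(** An admissible word is a path from exactly one diagonal cell, that of row [iot w]. The preceding
    letter is set to [R] so that an initial [L] counts as a descent. *)
Lemma word_polyE r : (0 < r)%N ->
  word_poly r b = \sum_(i < r) path_sum (b 1%N - 1) i.+1 i.+1 R.
Proof.
move=> r_gt0; rewrite /word_poly /path_sum.
under eq_bigr do rewrite word_weight_Dset.
under [RHS]eq_bigr do rewrite subnn.
rewrite (exchange_big_dep predT) //= big_mkcond; apply: eq_bigr => w _.
rewrite /admissible; case: leqP => [ell_w|ell_w] /=; last first.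
  rewrite big_pred0 // => i; rewrite path_wordE //.
  by case: eqP (ltn_ord i) => // -[->]; lia.
have w_lt : (ell w < r)%N by lia.
have pathE (i : 'I_r) : path_word i.+1 i.+1 w =
    (i == Ordinal w_lt) && path_word (iot w) (iot w) w.
  by rewrite !path_wordE // eqxx -val_eqE /= eqSS; case: eqP => // ->.
rewrite path_wordE // eqxx /= in pathE; case: ifP => adm; rewrite adm in pathE.
  by rewrite (big_pred1 (Ordinal w_lt)) // => i; rewrite pathE andbT.
by rewrite big_pred0 // => i; rewrite pathE andbF.
Qed.

End Words.

(** * Matching the two recursions modulo a power of t *)

Section Numerator.

Variables (r : nat) (b : nat -> nat).
Hypotheses (r_gt0 : (0 < r)%N) (shape : ferrers_shape r b).

Local Notation cells := (ferrers_cells r b).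
Local Notation G := (chains cells).

Lemma uniq_ferrers_cells : uniq cells.
Proof.
apply: allpairs_uniq_dep; first exact: iota_uniq.
  by move=> i _; apply: iota_uniq.
by move=> [i c] [j d] _ _ [-> ->].
Qed.

Lemma ferrers_cells_gt0 p : p \in cells -> (0 < p.1)%N.
Proof. by case: p => i c; rewrite mem_ferrers_cells => /andP[/andP[]]. Qed.

Lemma shape_antimono i j : (0 < i <= j)%N -> (j <= r)%N -> (b j <= b i)%N.
Proof.
case: shape => dec _ /andP[i_gt0]; elim: j => [|j IHj]; first lia.
rewrite leq_eqVlt => /orP[/eqP->//|ij] jr.
by apply: leq_trans (dec j _) (IHj _ _); lia.
Qed.

Lemma max_rank_ferrers : max_rank (@cell_rank cells) = (b 1%N - 1)%N.
Proof.
have [_ /(_ 1%N)] := shape; rewrite r_gt0 => /(_ isT) b1.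
apply/eqP; rewrite eqn_leq; apply/andP; split.
  apply/bigmax_leqP => -[[i c] ic] _; rewrite /cell_rank /cell_col /cell_row /=.
  move: (ic); rewrite mem_ferrers_cells => /andP[ir /andP[i_c c_b]].
  by have := @shape_antimono 1 i; lia.
have top : (1%N, b 1%N) \in cells by rewrite mem_ferrers_cells !leqnn r_gt0 b1.
exact: (@leq_bigmax _ (@cell_rank cells) (SeqSub top)).
Qed.

(* Each cell is counted once, in its row: the cells above [(i.+1, i.+1)] but   *)
(* not above [(i, i.+1)] are those of row [i.+1].                              *)
Lemma qzeta_ferrers m :
  qzeta (@cell_rank cells) m = \sum_(i < r) (G m i.+1 i.+1 - G m i i.+1).
Proof.
case: m => [|m].
  (* The empty chain is counted once, by row [1], because row [0] contributes nothing. *)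
  rewrite qzeta0 /= -(big_mkord xpredT (fun i => (0 < i.+1)%:R - (0 < i)%:R)).
  by rewrite (telescope_sumr (fun i => (0 < i)%:R)) // r_gt0 subr0.
rewrite (qzetaS uniq_ferrers_cells ferrers_cells_gt0).
have row (i : 'I_r) : G m.+1 i.+1 i.+1 - G m.+1 i i.+1 =
    \sum_(p <- cells | p.1 == i.+1) 'X^(p.2 - p.1) * G m p.1 p.2.
  rewrite /= (bigID (fun p : nat * nat => p.1 == i.+1)) /= -addrA.
  rewrite [X in _ + (X - _)](eq_bigl
    (fun p : nat * nat => (p.1 <= i)%N && (i < p.2)%N)).
    rewrite subrr addr0 big_seq_cond [RHS]big_seq_cond; apply: eq_bigl => -[j d] /=.
    rewrite mem_ferrers_cells; case: eqP => [->|]; rewrite ?andbF //.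
    by rewrite leqnn /= !andbT; case: (i < d)%N; rewrite ?andbT ?andbF.
  by move=> [j d] /=; rewrite -[(j <= i)%N]ltnS; case: (ltngtP j i.+1); rewrite ?andbF ?andbT.
rewrite (eq_bigr _ (fun i _ => row i)) (exchange_big_dep predT) //=.
rewrite big_seq [RHS]big_seq; apply: eq_bigr => -[[|j] d].
  by rewrite mem_ferrers_cells.
rewrite mem_ferrers_cells => /andP[/andP[_ j_lt] _].
by rewrite (big_pred1 (Ordinal j_lt)) // => i; rewrite eqSS eq_sym -val_eqE.
Qed.

Definition den_from (a : nat) : {poly {poly int}} :=
  \prod_(a <= k < b 1%N) (1 - ('X^k)%:P * 'X).

Lemma den_fromS a : (a < b 1%N)%N ->
  den_from a = (1 - ('X^a)%:P * 'X) * den_from a.+1.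
Proof. by move=> ab; rewrite /den_from big_ltn. Qed.

Variable N : nat.

(* Power series in t are handled as polynomials modulo [t^(N + 1)]. *)
Definition eqpX (p q : {poly {poly int}}) := exists u, p = q + u * 'X^(N.+1).

Lemma eqpX_sum n (F F' : 'I_n -> {poly {poly int}}) :
  (forall i, eqpX (F i) (F' i)) -> eqpX (\sum_i F i) (\sum_i F' i).
Proof.
move=> eqF; elim/big_ind2: _ => [|p p' q q' [u ->] [v ->]|i _]; last exact: eqF.
  by exists 0; rewrite mul0r addr0.
by exists (u + v); ring.
Qed.

Definition chain_poly i c : {poly {poly int}} := \poly_(m < N.+1) G m i c.

Lemma chain_poly_row0 c : chain_poly 0 c = 0.
Proof.
apply/polyP => m; rewrite coef_poly coef0 chains_row0 ?if_same //.
exact: ferrers_cells_gt0.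
Qed.

Lemma chain_poly_row1_end : chain_poly 1 (b 1%N).+1 = 1.
Proof.
apply/polyP => -[|m]; rewrite coef_poly coef1 //=; case: ifP => // _.
rewrite big_seq_cond big_pred0 // => -[j d] /=; rewrite mem_ferrers_cells.
by case: j => [|[|j]] //=; case: (ltnP (b 1%N) d); rewrite ?andbF.
Qed.

Lemma chain_poly_row_end i :
  chain_poly i.+2 (b i.+2).+1 = chain_poly i.+1 (b i.+2).+1.
Proof.
apply/polyP => m; rewrite !coef_poly (@chains_empty_row _ _ i.+1) //.
by move=> [j d]; rewrite mem_ferrers_cells /= => + ji; rewrite ji => /and3P[].
Qed.

Lemma chain_poly_recr i c : (i.+1, c) \in cells ->
  eqpX ((1 - ('X^(c - i.+1))%:P * 'X) * chain_poly i.+1 c)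
    (chain_poly i c + chain_poly i.+1 c.+1 - chain_poly i c.+1).
Proof.
(* Truncation loses a single term: the top coefficient pushed to degree [N.+1] by the factor
   ['X]. *)
move=> ic; exists (- ('X^(c - i.+1) * G N i.+1 c))%:P.
apply/polyP => m; rewrite coefD mulrBl mul1r -mulrA !coefB coefCM.
rewrite coefXM coefCM coefXn coefD !coef_poly.
case: m => [|m]; first by rewrite /=; ring.
rewrite !ltnS eqSS; case: (ltngtP m N) => [mN|mN|->].
- rewrite (chains_recr uniq_ferrers_cells) //=; ring.
- rewrite /=; ring.
- rewrite /=; ring.
Qed.

(** Every letter raises the rank by one, so [n] is the number of letters left before the top. The
    induction is strong because [x_LR] is two letters away. *)
Lemma path_sum_chain_poly n i c : (i, c) \in cells ->
  (n + (c - i) = b 1%N - 1)%N ->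
  eqpX (den_from (c - i) * chain_poly i c) (path_sum b n i c true).
Proof.
elim/ltn_ind: n i c => n IHn i c ic nE.
move: (ic); rewrite mem_ferrers_cells => /andP[/andP[i_gt0 ir] /andP[i_c c_b]].
have bi1 : (b i <= b 1)%N by apply: shape_antimono; rewrite ?i_gt0.
rewrite den_fromS; last by lia.
case: n => [|n] in IHn nE *.
  (* Only the top cell has maximal rank. *)
  have [i1 c1] : i = 1%N /\ c = b 1%N by lia.
  rewrite {}i1 {}c1 in ic i_gt0 *.
  have [u] := chain_poly_recr ic; rewrite !chain_poly_row0 chain_poly_row1_end => E.
  rewrite path_sum0 leqnn /= /den_from big_geq; last by lia.
  by exists u; rewrite mulr1 E; ring.
rewrite path_sumS ?i_gt0 //.
case: i => [//|[|i]] in ic nE i_gt0 ir i_c c_b bi1 *; rewrite /=.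
  have ic1 : (1%N, c.+1) \in cells by rewrite mem_ferrers_cells; lia.
  have [u] := chain_poly_recr ic; rewrite !chain_poly_row0 => E.
  have [|v Ev] := IHn n (ltnSn n) _ _ ic1; first lia.
  rewrite subSn // in Ev; rewrite path_sum_row1 -[path_sum _ _ _ _ _]addr0.
  exists (den_from (c - 1).+1 * u + v); rewrite mulrAC E.
  have -> : path_sum b n 1 c.+1 true =
    den_from (c - 1).+1 * chain_poly 1 c.+1 - v * 'X^(N.+1) by rewrite Ev addrK.
  ring.
have bi : (b i.+2 <= b i.+1)%N by apply: shape_antimono; lia.
have icL : (i.+1, c) \in cells by rewrite mem_ferrers_cells; lia.
have [u E] := chain_poly_recr ic.
have [|v] := IHn n (ltnSn n) _ _ icL; first lia.
have -> : (c - i.+1 = (c - i.+2).+1)%N by lia.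
set D := den_from _ => EL; rewrite mul1r mulrAC E.
have -> : path_sum b n i.+1 c true = D * chain_poly i.+1 c - v * 'X^(N.+1).
  by rewrite EL addrK.
(* At the end of a row no word continues with [R], while on the chain side the terms of [x_R] and
   [x_LR] cancel. *)
have [cb|cb] : c = b i.+2 \/ (c < b i.+2)%N by lia.
  rewrite path_sum_out; last by rewrite cb.
  have -> : chain_poly i.+2 c.+1 = chain_poly i.+1 c.+1 by rewrite cb chain_poly_row_end.
  exists (u * D + v); ring.
case: n => [|n] in IHn nE EL *; first by lia.
have icR : (i.+2, c.+1) \in cells by rewrite mem_ferrers_cells; lia.
have icRL : (i.+1, c.+1) \in cells by rewrite mem_ferrers_cells; lia.
rewrite path_sumR //; last by lia.
have [|v1] := IHn n.+1 (ltnSn _) _ _ icR; first lia.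
have [|v2] := IHn n (ltnW (ltnSn _)) _ _ icRL; first lia.
have -> : (c.+1 - i.+2 = (c - i.+2).+1)%N by lia.
have -> : (c.+1 - i.+1 = (c - i.+2).+2)%N by lia.
rewrite -/D /=.
have -> : D = (1 - ('X^((c - i.+2).+1))%:P * 'X) * den_from (c - i.+2).+2.
  by apply: den_fromS; lia.
set D' := den_from _ => ERL ER.
have -> : path_sum b n.+1 i.+2 c.+1 true =
    (1 - ('X^((c - i.+2).+1))%:P * 'X) * D' * chain_poly i.+2 c.+1 - v1 * 'X^(N.+1).
  by rewrite ER addrK.
have -> : path_sum b n i.+1 c.+1 true = D' * chain_poly i.+1 c.+1 - v2 * 'X^(N.+1).
  by rewrite ERL addrK.
set f := 1 - _.
(* The witness collects the truncation errors of the recursion and of the three induction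
   hypotheses. *)
exists (u * (f * D') + v + v1 - f * v2); ring.
Qed.

Lemma qzeta_numerator :
  eqpX (den_from 0 * \poly_(m < N.+1) qzeta (@cell_rank cells) m) (word_poly r b).
Proof.
have -> : \poly_(m < N.+1) qzeta (@cell_rank cells) m =
    \sum_(i < r) (chain_poly i.+1 i.+1 - chain_poly i i.+1).
  apply/polyP => m; rewrite coef_poly coef_sum qzeta_ferrers.
  case: ifP => mN; last by rewrite big1 // => i _; rewrite coefB !coef_poly mN subrr.
  by apply: eq_bigr => i _; rewrite coefB !coef_poly mN.
rewrite word_polyE // mulr_sumr; apply: eqpX_sum => -[i ir] /=.
have [_ /(_ i.+1)] := shape; rewrite ir => /(_ isT) bi.
have ii : (i.+1, i.+1) \in cells by rewrite mem_ferrers_cells; lia.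
have [|u] := @path_sum_chain_poly (b 1%N - 1) _ _ ii; first lia.
rewrite subnn; case: i => [|i] in ir bi ii *.
  by rewrite chain_poly_row0 subr0 path_sum_row1 => E; exists u.
have bi1 : (b i.+2 <= b i.+1)%N by apply: shape_antimono; lia.
have b1 : (b i.+2 <= b 1)%N by apply: shape_antimono; lia.
have iiL : (i.+1, i.+2) \in cells by rewrite mem_ferrers_cells; lia.
have [|v] := @path_sum_chain_poly (b 1%N - 2) _ _ iiL; first lia.
have -> : (b 1 - 1 = (b 1 - 2).+1)%N by lia.
(* The subtracted cell has rank [1], so [den_from 0] leaves a spare factor [1 - t] on it; this is
   the coefficient in [path_sumR] that makes an initial [L] a descent. *)
rewrite subSnn path_sumR ?leqnn // subnn (@den_fromS 0); last by lia.
set f := 1 - _ => EL E; exists (u - f * v); rewrite mulrBr E -mulrA EL /=; ring.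
Qed.

End Numerator.

(** * Characterization of the numerator and its positivity *)

Lemma is_qzeta_numerator_ferrers r b h : (0 < r)%N -> ferrers_shape r b ->
  is_qzeta_numerator (@cell_rank (ferrers_cells r b)) h <-> h = word_poly r b.
Proof.
move=> r_gt0 shape.
have den0 : qzeta_den (@cell_rank (ferrers_cells r b)) = den_from b 0.
  rewrite /qzeta_den max_rank_ferrers // /den_from big_mkord.
  by have [_ /(_ 1%N)] := shape; rewrite r_gt0 => /(_ isT) b1; rewrite subn1 prednK.
have coefE n : \sum_(k < n.+1) (qzeta_den (@cell_rank (ferrers_cells r b)))`_k
    * qzeta (@cell_rank (ferrers_cells r b)) (n - k) = (word_poly r b)`_n.
  (* Truncating at [N = n] suffices: the coefficient of degree [n] involves only chains of length at
     most [n]. *)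
  have [u] := qzeta_numerator r_gt0 shape n.
  move=> /(congr1 (fun p : {poly {poly int}} => p`_n)).
  rewrite coefD coefMXn ltnSn addr0 coefM => <-; rewrite den0.
  by apply: eq_bigr => k _; rewrite coef_poly ltnS leq_subr.
split=> [numh|-> //]; apply/polyP => n.
by rewrite -numh coefE.
Qed.

Lemma word_poly_over (S : semiringClosed int) r b :
  word_poly r b \is a polyOver (polyOver_pred S).
Proof.
rewrite /word_poly; apply: rpred_sum => w _; apply: rpredM; last exact: polyOverXn.
by rewrite polyOverC polyOverXn.
Qed.

Theorem theorem5p1 (r : nat) (r_ge1 : (1 <= r)%N) :
  (forall b : nat -> nat, ferrers_shape r b ->
     (forall h : {poly {poly int}},
        is_qzeta_numerator (@cell_rank (ferrers_cells r b)) h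
          <-> h = word_poly r b) /\
     (forall h : {poly {poly int}},
        is_qzeta_numerator (@cell_rank (ferrers_cells r b)) h ->
        h \is a polyOver (polyOver Num.nat))) /\
  (forall s : nat, (2 * r <= s)%N ->
     [/\ ferrers_shape r (fun i => s - i)%N,
         trapezoid_cells r s =i ferrers_cells r (fun i => s - i)%N &
         forall h : {poly {poly int}},
           is_qzeta_numerator (@cell_rank (trapezoid_cells r s)) h
             <-> h = word_poly r (fun i => s - i)%N]).
Proof.
split=> [b shape|s rs].
  split=> h; first exact: is_qzeta_numerator_ferrers.
  by move=> /(is_qzeta_numerator_ferrers _ r_ge1 shape) ->; exact: (word_poly_over _ r b).
have shape : ferrers_shape r (fun i => s - i)%N by split=> i; lia.
(* The trapezoid unfolds to the Ferrers cells of [s - i], so the two posets are convertible. *)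
by split=> // h; apply: is_qzeta_numerator_ferrers.
Qed.
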